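(* Let $c,c_0,c_1>0$ be constants and let $X>0$ be a large number. Let $\mathfrak{C}(X)$ be the set of integers $N=pq\le X$ with $p,q$ primes such that $q-p=a_12^{v_1}+\cdots+a_k2^{v_k}$ with $a_i\in\{-1,0,1\}$, $k\le c_0(\log\log N)^c$ and $1\le v_i\le c_1\log N$. Then every $N\in\mathfrak{C}(X)$ can be factored in deterministic superpolynomial time $O\big((\log N)^{O((\log\log N)^c)}\big)$ arithmetic operations.
   Context: Deterministic superpolynomial time means at most $(\log N)^{c_2(\log\log N)^{c}}$ arithmetic operations for a constant $c_2>0$. *)

(* Defs.v *)
From Stdlib Require Import Reals ZArith Znumtheory List.
Import ListNotations.
Open Scope Z_scope.

(** * Signed sums of powers of two and the set C(X) *)

(** A pair (a, v) in the list stands for the term a * 2^v. *)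
Definition signed_sum (l : list (Z * Z)) : Z :=
  fold_right Z.add 0 (map (fun t => fst t * 2 ^ snd t) l).

Definition loglog (N : Z) : R := ln (ln (IZR N)).

(** [Rpower] is the usual real power only for a positive base.  A product N of
    two primes is at least 4, so both ln N > 1 and ln (ln N) > 0. *)
Definition in_C (c c0 c1 X : R) (N : Z) : Prop :=
  (IZR N <= X)%R /\
  exists p q : Z,
    prime p /\ prime q /\ N = p * q /\
    exists l : list (Z * Z),
      q - p = signed_sum l /\
      (INR (length l) <= c0 * Rpower (loglog N) c)%R /\
      forall a v : Z, In (a, v) l ->
        (a = -1 \/ a = 0 \/ a = 1) /\
        1 <= v /\ (IZR v <= c1 * ln (IZR N))%R.

(** * Deterministic algorithms and their arithmetic operations

    Programs of an integer random access machine with bounded words.  All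
    values computed, loaded or stored (addresses included) have absolute value
    at most the word bound W; otherwise the program is stuck.  The bound
    matters: with unit-cost operations on unbounded integers, every integer
    can be factored in polynomially many operations (Shamir, 1979). *)

Definition state := Z -> Z.

Inductive binop := Add | Sub | Mul | Div | Mod.

Inductive expr :=
| Const (z : Z)
| Read (addr : expr)
| Op (o : binop) (e1 e2 : expr).

Inductive cmp := CEq | CLe | CLt.

Inductive test := Test (r : cmp) (e1 e2 : expr).

Inductive cmd :=
| Skip
| Store (addr e : expr)
| Seq (c1 c2 : cmd)
| If (b : test) (c1 c2 : cmd)
| While (b : test) (c : cmd).

(** Floor division, with Stdlib's total values at divisor 0. *)
Definition apply_op (o : binop) : Z -> Z -> Z :=
  match o with
  | Add => Z.add | Sub => Z.sub | Mul => Z.mul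
  | Div => Z.div | Mod => Z.modulo
  end.

Definition apply_cmp (r : cmp) : Z -> Z -> bool :=
  match r with CEq => Z.eqb | CLe => Z.leb | CLt => Z.ltb end.

Definition word (W x : Z) : option Z :=
  if Z.abs x <=? W then Some x else None.

Fixpoint eval (W : Z) (s : state) (e : expr) : option Z :=
  match e with
  | Const z => word W z
  | Read a =>
      match eval W s a with Some i => word W (s i) | None => None end
  | Op o e1 e2 =>
      match eval W s e1, eval W s e2 with
      | Some x, Some y => word W (apply_op o x y)
      | _, _ => None
      end
  end.

Definition eval_test (W : Z) (s : state) (b : test) : option bool :=
  let 'Test r e1 e2 := b in
  match eval W s e1, eval W s e2 with
  | Some x, Some y => Some (apply_cmp r x y)
  | _, _ => None
  end.

(** Unit cost for every constant, memory access, arithmetic operation,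
    comparison and control step, so the cost is an upper bound for the number
    of arithmetic operations proper. *)
Fixpoint expr_cost (e : expr) : nat :=
  match e with
  | Const _ => 1
  | Read a => S (expr_cost a)
  | Op _ e1 e2 => S (expr_cost e1 + expr_cost e2)
  end.

Definition test_cost (b : test) : nat :=
  let 'Test _ e1 e2 := b in S (expr_cost e1 + expr_cost e2).

Definition update (s : state) (i x : Z) : state :=
  fun j => if Z.eqb j i then x else s j.

(** [exec W P s t s']: with word bound W, the program P started in memory s
    halts in memory s' after t operations. *)
Inductive exec (W : Z) : cmd -> state -> nat -> state -> Prop :=
| exec_skip s : exec W Skip s 1 s
| exec_store a e s i x :
    eval W s a = Some i -> eval W s e = Some x ->
    exec W (Store a e) s (S (expr_cost a + expr_cost e)) (update s i x)
| exec_seq P Q s t s' t' s'' :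
    exec W P s t s' -> exec W Q s' t' s'' ->
    exec W (Seq P Q) s (t + t') s''
| exec_if b P Q s v t s' :
    eval_test W s b = Some v ->
    exec W (if v then P else Q) s t s' ->
    exec W (If b P Q) s (test_cost b + t) s'
| exec_while_false b P s :
    eval_test W s b = Some false ->
    exec W (While b P) s (test_cost b) s
| exec_while_true b P s t s' t' s'' :
    eval_test W s b = Some true ->
    exec W P s t s' -> exec W (While b P) s' t' s'' ->
    exec W (While b P) s (test_cost b + t + t') s''.

Lemma exec_deterministic W P s t1 s1 t2 s2 :
  exec W P s t1 s1 -> exec W P s t2 s2 -> t1 = t2 /\ s1 = s2.
Proof.
intros H; revert t2 s2.
induction H; intros u r H'; inversion H'; subst; try congruence.
- now split.
- split; congruence.
- match goal with A : exec W P _ _ _ |- _ =>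
    destruct (IHexec1 _ _ A); subst end.
  match goal with A : exec W Q _ _ _ |- _ =>
    destruct (IHexec2 _ _ A); subst end; now split.
- match goal with A : eval_test W s b = Some ?v0 |- _ =>
    assert (v0 = v) by congruence; subst v0 end.
  match goal with A : exec W (if v then _ else _) _ _ _ |- _ =>
    destruct (IHexec _ _ A); subst end; now split.
- now split.
- match goal with A : exec W P _ _ _ |- _ =>
    destruct (IHexec1 _ _ A); subst end.
  match goal with A : exec W (While b P) s'0 _ _ |- _ =>
    destruct (IHexec2 _ _ A); subst end; now split.
Qed.

(** The input N is in cell 0, all other cells are 0; the factors are returned
    in cells 0 and 1. *)
Definition input (N : Z) : state := fun i => if Z.eqb i 0 then N else 0.

Definition factors_in (P : cmd) (W N : Z) (t : nat) : Prop :=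
  exists s : state,
    exec W P (input N) t s /\
    prime (s 0) /\ prime (s 1) /\ N = s 0 * s 1.

(** (log N)^(c2 (log log N)^c) *)
Definition superpoly (c c2 : R) (N : Z) : R :=
  Rpower (ln (IZR N)) (c2 * Rpower (loglog N) c).

(* Main.v *)
From Stdlib Require Import Reals ZArith Znumtheory List Lia Lra.
Require Import Defs.

(** A difference [d = q - p] determines the factorization of [N = p q]: for
    fixed [d], the inequality [x (x + d) <= N] is monotone in [x >= 1], so [p] is
    found by bisection in [O(log N)] steps.  The program runs through
    [m = 0, 1, 2, ...] and reads the base-[B] digits of [m], with [B] of order
    [log N], as the terms of a candidate [d].  A difference with [k] terms is
    reached before [m = B^k], so neither [k] nor the real constants [c], [c0] need
    to be known to the program, and the cost is at most a constant times
    [B^(3 (k + 1))] with [ln B = O(log log N)] and [k = O((log log N)^c)].  As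
    [N >= 4] keeps [log log N] away from 0, all constants can be absorbed into
    [c2].  The words stay polynomial in [N] because [(log log N)^(c + 1) = O(log N)]. *)

Open Scope Z_scope.

(** * Total correctness with a time bound *)

(** The value without the word bound. Together with [safe], which collects the size conditions, it
    splits each use of [eval] into an equation and inequalities open to linear arithmetic. *)
Fixpoint den (s : state) (e : expr) : Z :=
  match e with
  | Const z => z
  | Read a => s (den s a)
  | Op o e1 e2 => apply_op o (den s e1) (den s e2)
  end.

Fixpoint safe (W : Z) (s : state) (e : expr) : Prop :=
  match e with
  | Const z => Z.abs z <= W
  | Read a => safe W s a /\ Z.abs (s (den s a)) <= W
  | Op o e1 e2 =>
      safe W s e1 /\ safe W s e2 /\
      Z.abs (apply_op o (den s e1) (den s e2)) <= W
  end.

Definition test_den (s : state) (b : test) : bool :=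
  let 'Test r e1 e2 := b in apply_cmp r (den s e1) (den s e2).

Definition test_safe (W : Z) (s : state) (b : test) : Prop :=
  let 'Test _ e1 e2 := b in safe W s e1 /\ safe W s e2.

Lemma word_Some W x : Z.abs x <= W -> word W x = Some x.
Proof. intros H; unfold word; now rewrite (proj2 (Z.leb_le _ _) H). Qed.

Lemma eval_safe W s e : safe W s e -> eval W s e = Some (den s e).
Proof.
induction e as [z | a IH | o e1 IH1 e2 IH2]; cbn [safe eval den].
- apply word_Some.
- intros [Ha Hs]; rewrite (IH Ha); now apply word_Some.
- intros [H1 [H2 H]]; rewrite (IH1 H1), (IH2 H2); now apply word_Some.
Qed.

Lemma eval_test_safe W s b :
  test_safe W s b -> eval_test W s b = Some (test_den s b).
Proof.
destruct b as [r e1 e2]; cbn; intros [H1 H2].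
now rewrite (eval_safe _ _ _ H1), (eval_safe _ _ _ H2).
Qed.

(** A total-correctness triple. [T] is only an upper bound, so time budgets can be rounded to
    convenient numbers. *)
Definition runs (W : Z) (P : cmd) (s : state) (T : nat) (Q : state -> Prop) :=
  exists t s', exec W P s t s' /\ (t <= T)%nat /\ Q s'.

Lemma runs_skip W s T (Q : state -> Prop) :
  (1 <= T)%nat -> Q s -> runs W Skip s T Q.
Proof. intros; exists 1%nat, s; repeat split; auto; constructor. Qed.

Lemma runs_store W a e s T (Q : state -> Prop) :
  safe W s a -> safe W s e ->
  (S (expr_cost a + expr_cost e) <= T)%nat ->
  Q (update s (den s a) (den s e)) -> runs W (Store a e) s T Q.
Proof.
intros Ha He HT HQ; do 2 eexists; split; [|split; [exact HT | exact HQ]].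
constructor; now apply eval_safe.
Qed.

Lemma runs_seq W P1 P2 s T1 T2 T (Q : state -> Prop) :
  (T1 + T2 <= T)%nat ->
  runs W P1 s T1 (fun s' => runs W P2 s' T2 Q) ->
  runs W (Seq P1 P2) s T Q.
Proof.
intros HT (t1 & s1 & E1 & L1 & t2 & s2 & E2 & L2 & HQ).
exists (t1 + t2)%nat, s2; split; [econstructor; eauto | split; [lia | auto]].
Qed.

Lemma runs_seq_store W a e P s T T' (Q : state -> Prop) :
  safe W s a -> safe W s e ->
  (S (expr_cost a + expr_cost e) + T' <= T)%nat ->
  runs W P (update s (den s a) (den s e)) T' Q ->
  runs W (Seq (Store a e) P) s T Q.
Proof.
intros Ha He HT HP; eapply runs_seq; [exact HT|].
now apply runs_store.
Qed.

Lemma runs_if W b P1 P2 s T T' (Q : state -> Prop) :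
  test_safe W s b -> (test_cost b + T' <= T)%nat ->
  runs W (if test_den s b then P1 else P2) s T' Q ->
  runs W (If b P1 P2) s T Q.
Proof.
intros Hb HT (t & s' & E & L & HQ).
exists (test_cost b + t)%nat, s'; split; [|split; [lia | auto]].
econstructor; [now apply eval_test_safe | auto].
Qed.

(* [Inv n] says in particular that at most [n] iterations remain. *)
Lemma runs_while W b P T (Inv : nat -> state -> Prop) (Q : state -> Prop) :
  (forall n s, Inv n s -> test_safe W s b /\
     if test_den s b
     then exists n', n = S n' /\ runs W P s T (Inv n')
     else Q s) ->
  forall n s T', Inv n s -> (n * (test_cost b + T) + test_cost b <= T')%nat ->
  runs W (While b P) s T' Q.
Proof.
intros H n; induction n as [n IH] using (well_founded_induction Wf_nat.lt_wf).
intros s T' HI HT; destruct (H _ _ HI) as [Hs Hb].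
pose proof (eval_test_safe _ _ _ Hs) as Ev.
destruct (test_den s b).
- destruct Hb as (n' & -> & t1 & s1 & E1 & L1 & HI').
  destruct (IH n' (Nat.lt_succ_diag_r n') s1 (T' - (test_cost b + T))%nat HI')
    as (t2 & s2 & E2 & L2 & HQ); [cbn in HT; lia|].
  exists (test_cost b + t1 + t2)%nat, s2; split; [|split; [cbn in HT; lia | auto]].
  econstructor; eauto.
- exists (test_cost b), s; split; [now constructor | split; [lia | auto]].
Qed.

Lemma runs_weaken W P s T T' (Q Q' : state -> Prop) :
  runs W P s T Q -> (T <= T')%nat -> (forall s', Q s' -> Q' s') ->
  runs W P s T' Q'.
Proof.
intros (t & s' & E & L & HQ) HT H; exists t, s'; repeat split; auto; lia.
Qed.

(** * The factoring program *)

Declare Scope expr_scope.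
Delimit Scope expr_scope with expr.
Notation "# i" := (Read (Const i)) (at level 1, format "# i") : expr_scope.
Infix "+" := (Op Add) : expr_scope.
Infix "-" := (Op Sub) : expr_scope.
Infix "*" := (Op Mul) : expr_scope.
Infix "/" := (Op Div) : expr_scope.
Infix "mod" := (Op Mod) : expr_scope.
Infix "<=" := (Test CLe) : expr_scope.
Infix "<" := (Test CLt) : expr_scope.
Infix "=" := (Test CEq) : expr_scope.
Notation "i <- e" := (Store (Const i) e%expr)
  (at level 90, e at level 85) : expr_scope.
Notation "P ;; Q" := (Seq P Q) (at level 100, Q at level 200) : expr_scope.

(* Registers: 0 holds N, 1 the cofactor once it is found, 2 the bit length of
   N and then the base B, 4 the counter m, 5 the decoded difference d.
   Registers 3, 6, 7, 8, 9, 10 are scratch. *)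

Definition bit_length_loop : cmd :=
  While (Const 0 < #3)%expr
    (3 <- #3 / Const 2;; 2 <- #2 + Const 1)%expr.

Definition pow_loop : cmd :=
  While (Const 0 < #6)%expr
    (8 <- Const 2 * #8;; 6 <- #6 - Const 1)%expr.

Definition decode_loop : cmd :=
  While (Const 0 < #3)%expr
    (7 <- #3 mod #2;; 3 <- #3 / #2;; 6 <- #7 / Const 3;; 8 <- Const 1;;
     pow_loop;;
     5 <- #5 + ((#7 + Const 1) mod Const 3 - Const 1) * #8)%expr.

Definition bisect_loop : cmd :=
  While (#8 + Const 1 < #9)%expr
    (10 <- (#8 + #9) / Const 2;;
     If (#10 * (#10 + #5) <= #0)%expr (8 <- #10) (9 <- #10))%expr.

(** The test on [#8] rejects the trivial factorization 1 * N, which appears for the candidate d = N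
    - 1. Writing a nonzero cofactor into register 1 also ends the search. *)
Definition search_body : cmd :=
  (3 <- #4;; 5 <- Const 0;; decode_loop;;
   8 <- Const 1;; 9 <- #0;; bisect_loop;;
   If (#8 * (#8 + #5) = #0)%expr
     (If (Const 1 < #8)%expr (1 <- #8 + #5;; 0 <- #8) Skip) Skip;;
   4 <- #4 + Const 1)%expr.

Definition search_loop : cmd := While (#1 = Const 0)%expr search_body.

(** With L the bit length of N, base 3 (C L + 1) has one digit for each residue mod 3 and each
    exponent from 0 to C L. *)
Definition factor_prog (C : Z) : cmd :=
  (3 <- #0;; bit_length_loop;;
   2 <- Const 3 * (Const C * #2 + Const 1);; search_loop)%expr.

(** Symbolic execution: computes costs, word conditions and register reads after updates, leaving
    integer arithmetic. *)
Ltac reg :=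
  cbn [den safe test_den test_safe apply_op apply_cmp expr_cost test_cost
       update Z.eqb Pos.eqb Nat.add] in *;
  unfold update in *;
  cbn [Z.eqb Pos.eqb] in *.

(** * Correctness and cost of the inner loops, with the digit code they decode *)

Lemma bit_length_loop_runs W N s :
  4 <= N -> 16 * N <= W -> s 3 = N -> s 2 = 0 ->
  runs W bit_length_loop s (20 * Z.to_nat (Z.log2 N + 1) + 20)
    (fun s' => s' 2 = Z.log2 N + 1 /\
       forall i, i <> 2 -> i <> 3 -> s' i = s i).
Proof.
intros HN HW H3 H2.
pose proof (Z.log2_nonneg N) as Hlog.
pose proof (Z.log2_spec N ltac:(lia)) as [Hl1 Hl2].
assert (Z.log2 N < N) by (apply Z.log2_lt_lin; lia).
apply runs_while with (T := 12%nat)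
  (n := Z.to_nat (Z.log2 N + 1))
  (Inv := fun n s' => 0 <= s' 2 /\ s' 2 + Z.of_nat n = Z.log2 N + 1 /\
     s' 3 = N / 2 ^ s' 2 /\ forall i, i <> 2 -> i <> 3 -> s' i = s i).
- intros n s' (I0 & I1 & I2 & I3).
  assert (0 < 2 ^ s' 2) by (apply Z.pow_pos_nonneg; lia).
  assert (0 <= s' 3 <= N).
  { rewrite I2; split; [apply Z.div_pos; lia|].
    apply Z.div_le_upper_bound; nia. }
  split; [reg; lia|].
  reg; destruct (Z.ltb_spec 0 (s' 3)).
  + destruct n as [|n].
    (* With no iteration left, [s' 2] is log2 N + 1 and the quotient is already 0. *)
    { replace (s' 2) with (Z.succ (Z.log2 N)) in I2 by lia.
      rewrite Z.div_small in I2; lia. }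
    exists n; split; [reflexivity|].
    assert (0 <= s' 3 / 2 <= N)
      by (split; [apply Z.div_pos | apply Z.div_le_upper_bound]; lia).
    apply runs_seq_store with (T' := 6%nat); reg; try lia.
    apply runs_store; reg; try lia.
    repeat split; try lia.
    * rewrite I2, Z.pow_add_r, Z.div_div; try lia.
      now rewrite Z.pow_1_r.
    * intros i Hi Hi'; rewrite (proj2 (Z.eqb_neq _ _) Hi), (proj2 (Z.eqb_neq _ _) Hi').
      auto.
  + split; [|auto].
    (* A zero quotient means N < 2^(s' 2), so the loop cannot have stopped before log2 N + 1
       halvings. *)
    assert (N / 2 ^ s' 2 = 0) as E by lia.
    apply Z.div_small_iff in E; [|lia].
    assert (~ s' 2 <= Z.log2 N); [|lia].
    intros Hle; apply (Z.pow_le_mono_r 2) in Hle; lia.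
- rewrite H2, H3, Z.pow_0_r, Z.div_1_r; repeat split; auto; lia.
- cbn; lia.
Qed.

Lemma pow_loop_runs W b v s :
  0 <= v <= Z.of_nat b -> 2 ^ v <= W -> 16 <= W -> v <= W ->
  s 6 = v -> s 8 = 1 ->
  runs W pow_loop s (20 * b + 20)
    (fun s' => s' 8 = 2 ^ v /\ forall i, i <> 6 -> i <> 8 -> s' i = s i).
Proof.
intros Hv HW HW' HvW H6 H8.
(* Counting with [b] instead of [v] gives one cost bound for all digits. *)
apply runs_while with (T := 12%nat) (n := b)
  (Inv := fun n s' => 0 <= s' 6 <= Z.of_nat n /\ s' 6 <= v /\ 1 <= s' 8 /\
     s' 8 * 2 ^ s' 6 = 2 ^ v /\ forall i, i <> 6 -> i <> 8 -> s' i = s i).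
- intros n s' (I0 & I0' & I1 & I2 & I3).
  split; [reg; lia|].
  reg; destruct (Z.ltb_spec 0 (s' 6)).
  + destruct n as [|n]; [lia|].
    exists n; split; [reflexivity|].
    assert (2 ^ s' 6 = 2 * 2 ^ (s' 6 - 1)) as E
      by (rewrite <- Z.pow_succ_r by lia; f_equal; lia).
    assert (0 < 2 ^ (s' 6 - 1)) by (apply Z.pow_pos_nonneg; lia).
    assert (2 * s' 8 <= 2 ^ v) by nia.
    apply runs_seq_store with (T' := 6%nat); reg; try lia.
    apply runs_store; reg; try lia.
    repeat split; try lia.
    intros i Hi Hi'; rewrite (proj2 (Z.eqb_neq _ _) Hi), (proj2 (Z.eqb_neq _ _) Hi').
    auto.
  + split; [|auto].
    replace (s' 6) with 0 in I2 by lia; lia.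
- rewrite H6, H8; repeat split; auto; lia.
- cbn; lia.
Qed.

(* The digit 3 v + (a mod 3) stands for the term a * 2^v with a in {-1,0,1};
   in particular the digit 0 stands for 0, so leading zeros are harmless. *)
Definition digit_term (j : Z) : Z := ((j + 1) mod 3 - 1) * 2 ^ (j / 3).

(** Least significant digit first, the order in which [decode_loop] splits digits off. *)
Definition digits_value (B : Z) (ds : list Z) : Z :=
  fold_right (fun j x => j + B * x) 0 ds.

Definition digits_sum (ds : list Z) : Z :=
  fold_right (fun j x => digit_term j + x) 0 ds.

Definition digits (B : Z) (ds : list Z) : Prop := Forall (fun j => 0 <= j < B) ds.

Lemma digit_term_bound V j :
  0 <= j < 3 * (V + 1) -> Z.abs (digit_term j) <= 2 ^ V.
Proof.
intros Hj; unfold digit_term.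
assert (0 <= j / 3 <= V)
  by (split; [apply Z.div_pos | apply Z.lt_succ_r, Z.div_lt_upper_bound]; lia).
assert (0 < 2 ^ (j / 3)) by (apply Z.pow_pos_nonneg; lia).
assert (2 ^ (j / 3) <= 2 ^ V) by (apply Z.pow_le_mono_r; lia).
pose proof (Z.mod_pos_bound (j + 1) 3 ltac:(lia)).
rewrite Z.abs_mul, (Z.abs_eq (2 ^ _)) by lia; nia.
Qed.

Lemma digits_value_nonneg B ds : 0 < B -> digits B ds -> 0 <= digits_value B ds.
Proof. intros HB; unfold digits_value; induction 1; cbn; nia. Qed.

(** Needed because decoding stops once the remaining value is 0, while the digit string may still
    continue with zeros. *)
Lemma digits_sum_zero B ds :
  0 < B -> digits B ds -> digits_value B ds = 0 -> digits_sum ds = 0.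
Proof.
intros HB; induction 1 as [|j ds Hj Hds IH]; cbn; [reflexivity|]; intros E.
fold (digits_value B ds) in E; fold (digits_sum ds).
pose proof (digits_value_nonneg B ds HB Hds).
assert (j = 0) as -> by nia; assert (digits_value B ds = 0) by nia.
rewrite IH by assumption; reflexivity.
Qed.

Lemma digits_value_lt B ds :
  0 < B -> digits B ds -> digits_value B ds < B ^ Z.of_nat (length ds).
Proof.
intros HB; induction 1 as [|j ds Hj Hds IH]; [reflexivity|].
cbn [length digits_value fold_right]; fold (digits_value B ds).
rewrite Nat2Z.inj_succ, Z.pow_succ_r by lia; nia.
Qed.

(** The program never sees a digit string; quantifying over all strings of value m lets the caller
    supply the one that encodes q - p. *)
Lemma decode_loop_runs W V B m b s :
  B = 3 * (V + 1) ->
  0 <= V -> 0 <= m -> B <= Z.of_nat b -> 16 + B + (m + 1) * 2 ^ V <= W ->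
  s 2 = B -> s 3 = m -> s 5 = 0 ->
  runs W decode_loop s (Z.to_nat m * (20 * b + 100) + 10)
    (fun s' => Z.abs (s' 5) <= m * 2 ^ V /\
       (forall ds, digits B ds -> digits_value B ds = m ->
          s' 5 = digits_sum ds) /\
       s' 0 = s 0 /\ s' 1 = s 1 /\ s' 2 = s 2 /\ s' 4 = s 4).
Proof.
intros HB HV Hm Hb HW H2 H3 H5.
assert (0 < 2 ^ V) by (apply Z.pow_pos_nonneg; lia).
assert (V < 2 ^ V) by (apply Z.pow_gt_lin_r; lia).
(* Each round lowers [s' 3] by at least 1 and adds a term of size at most 2^V, so |s' 5| + s' 3 *
   2^V never grows; the same count gives the crude bound of m rounds. [ds'] is the unread part of
   [ds]. *)
apply runs_while with (T := (20 * b + 90)%nat) (n := Z.to_nat m)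
  (Inv := fun n s' => 0 <= s' 3 <= Z.of_nat n /\
     Z.abs (s' 5) + s' 3 * 2 ^ V <= m * 2 ^ V /\
     (forall ds, digits B ds -> digits_value B ds = m ->
        exists ds', digits B ds' /\ digits_value B ds' = s' 3 /\
          s' 5 + digits_sum ds' = digits_sum ds) /\
     s' 0 = s 0 /\ s' 1 = s 1 /\ s' 2 = s 2 /\ s' 4 = s 4).
- intros n s' (I0 & I1 & I2 & I3 & I4 & I5 & I6).
  assert (s' 3 <= m) by (apply Z.mul_le_mono_pos_r with (2 ^ V); lia).
  assert (s' 3 <= s' 3 * 2 ^ V) by nia.
  assert (m <= m * 2 ^ V) by nia.
  split; [reg; lia|].
  reg; destruct (Z.ltb_spec 0 (s' 3)).
  + destruct n as [|n]; [lia|].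
    exists n; split; [reflexivity|].
    remember (s' 3) as x eqn:Ex; symmetry in Ex.
    remember (x mod B) as j eqn:Ej; remember (x / B) as y eqn:Ey.
    pose proof (Z.mod_pos_bound x B ltac:(lia)) as Hj; rewrite <- Ej in Hj.
    pose proof (Z.div_mod x B ltac:(lia)) as Hx; rewrite <- Ej, <- Ey in Hx.
    assert (0 <= y < x)
      by (rewrite Ey; split; [apply Z.div_pos | apply Z.div_lt]; lia).
    assert (y * 2 ^ V + 2 ^ V <= x * 2 ^ V) by nia.
    assert (0 <= j / 3 <= V)
      by (split; [apply Z.div_pos | apply Z.lt_succ_r, Z.div_lt_upper_bound]; lia).
    assert (0 < 2 ^ (j / 3) <= 2 ^ V)
      by (split; [apply Z.pow_pos_nonneg | apply Z.pow_le_mono_r]; lia).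
    pose proof (digit_term_bound V j ltac:(lia)) as Ht.
    pose proof (Z.mod_pos_bound (j + 1) 3 ltac:(lia)).
    rewrite H2 in I5.
    apply runs_seq_store with (T' := (20 * b + 80)%nat); reg;
      rewrite ?Ex, ?I5, <- ?Ej; try lia.
    apply runs_seq_store with (T' := (20 * b + 70)%nat); reg;
      rewrite ?Ex, ?I5, <- ?Ej, <- ?Ey; try lia.
    apply runs_seq_store with (T' := (20 * b + 60)%nat); reg; try lia.
    apply runs_seq_store with (T' := (20 * b + 50)%nat); reg; try lia.
    apply runs_seq with (T1 := (20 * b + 20)%nat) (T2 := 30%nat); [lia|].
    eapply runs_weaken; [apply (pow_loop_runs W b (j / 3)) | |]; reg; try lia.
    intros s1 (P8 & Pf).
    pose proof (Pf 7 ltac:(lia) ltac:(lia)) as P7.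
    pose proof (Pf 5 ltac:(lia) ltac:(lia)) as P5.
    pose proof (Pf 3 ltac:(lia) ltac:(lia)) as P3.
    pose proof (Pf 0 ltac:(lia) ltac:(lia)) as P0.
    pose proof (Pf 1 ltac:(lia) ltac:(lia)) as P1.
    pose proof (Pf 2 ltac:(lia) ltac:(lia)) as P2.
    pose proof (Pf 4 ltac:(lia) ltac:(lia)) as P4.
    clear Pf; reg.
    assert (s1 5 + ((s1 7 + 1) mod 3 - 1) * s1 8 = s' 5 + digit_term j) as E
      by (rewrite P5, P7, P8; reflexivity).
    apply runs_store; reg; rewrite ?E; rewrite ?P5, ?P7, ?P8; try lia.
    { fold (digit_term j); lia. }
    rewrite P3, P0, P1, P2, P4.
    split; [lia|]; split; [lia|]; split; [|repeat split; congruence].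
    intros ds Hds Hm'; destruct (I2 ds Hds Hm') as (ds' & D1 & D2 & D3).
    destruct D1 as [|j' ds' Hj' D1]; [cbn in D2; lia|].
    cbn in D2, D3; fold (digits_value B ds') in D2; fold (digits_sum ds') in D3.
    (* Uniqueness of quotient and remainder identifies the head of the string with the digit just
       read. *)
    assert (j' = j /\ digits_value B ds' = y) as [-> Ey'].
    { apply and_comm, (Z.div_mod_unique B); lia. }
    exists ds'; repeat split; auto; lia.
  + split; [lia|]; split; [|auto].
    intros ds Hds Hm'; destruct (I2 ds Hds Hm') as (ds' & D1 & D2 & D3).
    rewrite (digits_sum_zero B ds') in D3; lia || auto; lia.
- rewrite H3, H5; split; [lia|]; split; [lia|]; split; [|auto].
  intros ds Hds Hm'; exists ds; repeat split; auto; lia.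
- cbn [test_cost expr_cost]; lia.
Qed.

(** A solution p >= 1 has p + d > 0, so comparing k (k + d) with N places k correctly relative to p
    even where x (x + d) decreases. Every solution thus stays in the half-open interval from [s' 8]
    to [s' 9], which is halved down to one integer. *)
Lemma bisect_loop_runs W N d D b s :
  4 <= N -> Z.abs d <= D -> N <= 2 ^ Z.of_nat b -> 4 * N * (N + D) <= W ->
  s 0 = N -> s 5 = d -> s 8 = 1 -> s 9 = N ->
  runs W bisect_loop s (80 * b + 20)
    (fun s' => 1 <= s' 8 < N /\
       (forall p, 1 <= p < N -> p * (p + d) = N -> s' 8 = p) /\
       s' 0 = s 0 /\ s' 1 = s 1 /\ s' 2 = s 2 /\ s' 4 = s 4 /\ s' 5 = s 5).
Proof.
intros HN Hd Hb HW H0 H5 H8 H9.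
(* These products let linear arithmetic verify the word bound throughout the loop. *)
assert (0 <= D) by lia.
assert (0 <= N * D) by nia.
assert (4 * D <= N * D) by nia.
assert (4 * N <= N * N) by nia.
apply runs_while with (T := 60%nat) (n := b)
  (Inv := fun n s' => 1 <= s' 8 < s' 9 /\ s' 9 <= N /\
     s' 9 - s' 8 <= 2 ^ Z.of_nat n /\
     (forall p, 1 <= p < N -> p * (p + d) = N -> s' 8 <= p < s' 9) /\
     s' 0 = s 0 /\ s' 1 = s 1 /\ s' 2 = s 2 /\ s' 4 = s 4 /\ s' 5 = s 5).
- intros n s' (I0 & I0' & I1 & I2 & I3 & I4 & I5 & I6 & I7).
  split; [reg; lia|].
  reg; destruct (Z.ltb_spec (s' 8 + 1) (s' 9)).
  + destruct n as [|n]; [cbn in I1; lia|].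
    exists n; split; [reflexivity|].
    rewrite Nat2Z.inj_succ, Z.pow_succ_r in I1 by lia.
    remember ((s' 8 + s' 9) / 2) as k eqn:Ek.
    assert (2 * k <= s' 8 + s' 9 < 2 * k + 2)
      by (subst k; pose proof (Z.div_mod (s' 8 + s' 9) 2);
          pose proof (Z.mod_pos_bound (s' 8 + s' 9) 2); lia).
    assert (Z.abs (k * (k + d)) <= N * (N + D))
      by (rewrite Z.abs_mul; apply Z.mul_le_mono_nonneg; lia).
    apply runs_seq_store with (T' := 40%nat); reg; rewrite <- ?Ek; try lia.
    apply runs_if with (T' := 20%nat); reg; rewrite ?I3, ?I7, ?H0, ?H5; try lia.
    destruct (Z.leb_spec (k * (k + d)) N).
    * apply runs_store; reg; try lia.
      do 3 (split; [lia|]); split; [|repeat split; congruence].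
      intros p Hp Ep; specialize (I2 p Hp Ep).
      split; [|lia]; apply Z.nlt_ge; intros Hlt.
      assert (0 < p + d) by (apply Z.mul_pos_cancel_l with p; lia).
      pose proof (Z.mul_lt_mono_nonneg p k (p + d) (k + d)); lia.
    * apply runs_store; reg; try lia.
      do 3 (split; [lia|]); split; [|repeat split; congruence].
      intros p Hp Ep; specialize (I2 p Hp Ep).
      split; [lia|]; apply Z.nle_gt; intros Hle.
      (* Here k (k + d) > N > 0 supplies the sign that the monotonicity argument needs. *)
      assert (0 < k + d) by (apply Z.mul_pos_cancel_l with k; lia).
      pose proof (Z.mul_le_mono_nonneg k p (k + d) (p + d)); lia.
  + split; [lia|]; split; [|repeat split; congruence].
    intros p Hp Ep; specialize (I2 p Hp Ep); lia.
- rewrite H8, H9; do 3 (split; [lia|]); split; [|repeat split; congruence]; lia.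
- cbn [test_cost expr_cost]; lia.
Qed.

(** * The search and the whole program *)

(** The search may succeed at a candidate other than q - p; this makes any nontrivial hit a correct
    answer. The prime p divides x or y, and the remaining cofactor divides the prime q. *)
Lemma prime_mul_factors p q x y :
  prime p -> prime q -> x * y = p * q -> 1 < x < p * q -> prime x /\ prime y.
Proof.
intros Hp Hq E Hx.
pose proof (prime_ge_2 p Hp); pose proof (prime_ge_2 q Hq).
destruct (prime_mult p Hp x y) as [[k ->] | [k ->]].
- exists q; lia.
- assert (k * y = q) by nia.
  destruct (prime_divisors q Hq k) as [ | [ | [ | ]]]; [exists y; lia | nia | | nia | nia].
  subst k; replace (1 * p) with p by lia; replace y with q by lia; auto.
- assert (x * k = q) by nia.
  destruct (prime_divisors q Hq x) as [ | [ | [ | ]]]; [exists k; lia | lia | lia | | lia].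
  subst x; replace (k * p) with p by nia; auto.
Qed.

Lemma search_loop_runs W V B b p q ds s :
  let N := p * q in
  let m0 := digits_value B ds in
  B = 3 * (V + 1) -> 0 <= V -> B <= Z.of_nat b -> N <= 2 ^ Z.of_nat b ->
  prime p -> prime q -> digits B ds -> digits_sum ds = q - p ->
  16 + B + 4 * N * (N + (m0 + 1) * 2 ^ V) <= W ->
  s 0 = N -> s 1 = 0 -> s 2 = B -> s 4 = 0 ->
  runs W search_loop s
    ((Z.to_nat m0 + 1) * (Z.to_nat m0 * (20 * b + 100) + 80 * b + 200) + 10)
    (fun s' => prime (s' 0) /\ prime (s' 1) /\ N = s' 0 * s' 1).
Proof.
intros N m0 HB HV Hb HNb Hp Hq Hds Hsum HW H0 H1 H2 H4.
pose proof (prime_ge_2 p Hp); pose proof (prime_ge_2 q Hq).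
assert (4 <= N) by (unfold N; nia).
assert (1 <= p < N) by (unfold N; nia).
assert (0 <= m0) by (apply digits_value_nonneg; auto; lia).
assert (0 < 2 ^ V) by (apply Z.pow_pos_nonneg; lia).
assert (p * q = N) as HpN by reflexivity.
clearbody N.
assert (m0 <= m0 * 2 ^ V) by nia.
assert (4 * ((m0 + 1) * 2 ^ V) <= N * ((m0 + 1) * 2 ^ V)) by nia.
assert (4 * N <= N * N) by nia.
(* Either the factors have been found, or the counter is still at most [m0]. The clause 1 <= n
   forbids a failure at [m0] itself. *)
apply runs_while with (n := (Z.to_nat m0 + 1)%nat)
  (T := (Z.to_nat m0 * (20 * b + 100) + 80 * b + 190)%nat)
  (Inv := fun n s' =>
     s' 1 <> 0 /\ Z.abs (s' 1) <= W /\
     prime (s' 0) /\ prime (s' 1) /\ N = s' 0 * s' 1 \/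
     (1 <= n)%nat /\ s' 0 = N /\ s' 1 = 0 /\ s' 2 = B /\ 0 <= s' 4 /\
     s' 4 + Z.of_nat n = m0 + 1).
- intros n s' [(I1 & I1' & I) | (In & I0 & I1 & I2 & I4 & I4')].
  { split; [reg; lia|]; reg.
    now rewrite (proj2 (Z.eqb_neq _ _) I1). }
  split; [reg; lia|]; reg.
  rewrite I1; cbn [Z.eqb].
  destruct n as [|n]; [lia|]; exists n; split; [reflexivity|].
  remember (s' 4) as m eqn:Em; symmetry in Em.
  assert (m <= m0) by lia.
  assert (m * 2 ^ V <= m0 * 2 ^ V) by nia.
  assert (N * (m * 2 ^ V) <= N * (m0 * 2 ^ V)) by nia.
  assert (0 <= m * 2 ^ V) by nia.
  assert (Z.to_nat m * (20 * b + 100) <= Z.to_nat m0 * (20 * b + 100))%nat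
    by (apply Nat.mul_le_mono_r; lia).
  set (T := (Z.to_nat m0 * (20 * b + 100))%nat) in *.
  apply runs_seq_store with (T' := (T + 80 * b + 180)%nat); reg; try lia.
  apply runs_seq_store with (T' := (T + 80 * b + 170)%nat); reg; try lia.
  apply runs_seq with (T1 := (T + 10)%nat) (T2 := (80 * b + 160)%nat); [lia|].
  eapply runs_weaken; [apply (decode_loop_runs W V B m b) | |]; reg; try lia.
  intros s1 (D & Dsum & D0 & D1 & D2 & D4); reg.
  remember (s1 5) as d eqn:Ed; symmetry in Ed.
  apply runs_seq_store with (T' := (80 * b + 150)%nat); reg; try lia.
  apply runs_seq_store with (T' := (80 * b + 140)%nat); reg; try lia.
  apply runs_seq with (T1 := (80 * b + 20)%nat) (T2 := 120%nat); [lia|].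
  eapply runs_weaken; [apply (bisect_loop_runs W N d (m * 2 ^ V) b) | |];
    reg; try lia.
  intros s2 (F & Fp & F0 & F1 & F2 & F4 & F5); reg.
  remember (s2 8) as x eqn:Ex; symmetry in Ex.
  assert (Z.abs (x * (x + d)) <= N * (N + m * 2 ^ V))
    by (rewrite Z.abs_mul; apply Z.mul_le_mono_nonneg; lia).
  apply runs_seq with (T1 := 100%nat) (T2 := 20%nat); [lia|].
  (* At [m0] the decoded difference is q - p, for which p solves x (x + d) = N. *)
  assert (m = m0 -> x = p) as Hfound.
  { intros E; symmetry in E; apply Fp; [lia|].
    rewrite (Dsum ds Hds E), Hsum; lia. }
  apply runs_if with (T' := 80%nat); reg;
    rewrite ?F0, ?F5, ?Ed, ?Ex, ?D0, ?I0; try lia.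
  destruct (Z.eqb_spec (x * (x + d)) N) as [E | E].
  + apply runs_if with (T' := 60%nat); reg; rewrite ?Ex; try lia.
    destruct (Z.ltb_spec 1 x) as [Hx | Hx].
    * apply runs_seq_store with (T' := 50%nat); reg; try lia.
      apply runs_store; reg; [lia | lia | lia |].
      apply runs_store; reg; [lia | lia | lia |].
      left; rewrite Ex, F5, Ed.
      assert (x + d <> 0) by (intros E0; rewrite E0 in E; lia).
      destruct (prime_mul_factors p q x (x + d) Hp Hq) as [Px Py]; [lia | lia |].
      do 2 (split; [lia|]); auto.
    * apply runs_skip; [lia|].
      apply runs_store; reg; [lia | lia | lia |].
      right; repeat split; lia.
  + apply runs_skip; [lia|].
    assert (m <> m0).
    { intros E0; apply E; rewrite (Hfound E0), (Dsum ds Hds (eq_sym E0)), Hsum; lia. }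
    apply runs_store; reg; [lia | lia | lia |].
    right; repeat split; lia.
- right; repeat split; lia.
- cbn [test_cost expr_cost]; lia.
Qed.

Lemma search_time_bound m b M :
  0 <= m -> m + 1 <= M -> 0 <= b <= M ->
  (m + 1) * (m * (20 * b + 100) + 80 * b + 200) <= 400 * M ^ 3.
Proof.
intros Hm HM Hb.
assert (1 <= M) by lia.
apply Z.le_trans with (M * (M * (120 * M) + 280 * M)).
- apply Z.mul_le_mono_nonneg; [lia | lia | nia |].
  pose proof (Z.mul_le_mono_nonneg m (M - 1) (20 * b + 100) (120 * M)).
  lia.
- replace (M ^ 3) with (M * (M * M)) by ring.
  assert (M <= M * M) by nia; nia.
Qed.

(** The exponent is one more than the number of digits so that [M] dominates [B] as well as the last
    counter value, even for an empty string; the cost is then cubic in [M]. *)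
Lemma factor_prog_runs W C p q ds :
  let N := p * q in
  let V := C * (Z.log2 N + 1) in
  let B := 3 * (V + 1) in
  let M := B ^ (Z.of_nat (length ds) + 1) in
  1 <= C -> prime p -> prime q -> digits B ds -> digits_sum ds = q - p ->
  8 * N * (N + M * 2 ^ V) <= W ->
  exists t, factors_in (factor_prog C) W N t /\ Z.of_nat t <= 1000 * M ^ 3.
Proof.
intros N V B M HC Hp Hq Hds Hsum HW.
pose proof (prime_ge_2 p Hp); pose proof (prime_ge_2 q Hq).
assert (4 <= N) by (unfold N; nia).
pose proof (Z.log2_nonneg N) as Hlog.
pose proof (Z.log2_spec N ltac:(lia)) as [_ Hl2].
assert (Z.log2 N + 1 <= V) by (unfold V; nia).
assert (C <= V) by (unfold V; nia).
assert (0 < 2 ^ V) by (apply Z.pow_pos_nonneg; lia).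
assert (B <= B * B ^ Z.of_nat (length ds)) as A0.
{ assert (0 < B ^ Z.of_nat (length ds)) by (apply Z.pow_pos_nonneg; lia). nia. }
pose proof (digits_value_lt B ds ltac:(lia) Hds) as Hm.
pose proof (digits_value_nonneg B ds ltac:(lia) Hds) as Hm'.
set (m0 := digits_value B ds) in *.
assert (M = B * B ^ Z.of_nat (length ds)) as EM
  by (unfold M; rewrite Z.pow_add_r, Z.pow_1_r; lia).
assert (B <= M) by lia.
assert (m0 + 1 <= M) by nia.
assert (m0 * 2 ^ V + 2 ^ V <= M * 2 ^ V) as A1 by nia.
assert (M <= M * 2 ^ V) as A2 by nia.
assert (4 * (M * 2 ^ V) <= N * (M * 2 ^ V)) as A3 by nia.
assert (N * (m0 * 2 ^ V + 2 ^ V) <= N * (M * 2 ^ V)) as A4 by nia.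
assert (4 * N <= N * N) as A5 by nia.
assert (16 + B + 4 * N * (N + (m0 + 1) * 2 ^ V) <= W) as HW' by lia.
assert (16 * N <= W) by lia.
assert (16 + B <= W) by lia.
clear HW A0 A1 A2 A3 A4 A5 EM.
(* One number bounds both the exponents decoded from digits and the bisection steps, since log2 N +
   1 <= V < B. *)
set (b := Z.to_nat B).
assert (B <= Z.of_nat b) by (unfold b; lia).
set (m := Z.to_nat m0).
assert (N <= 2 ^ Z.of_nat b).
{ apply Z.lt_le_incl, Z.lt_le_trans with (1 := Hl2), Z.pow_le_mono_r; lia. }
set (T := ((m + 1) * (m * (20 * b + 100) + 80 * b + 200) + 10)%nat).
set (T0 := (20 * Z.to_nat (Z.log2 N + 1) + 20)%nat).
assert (runs W (factor_prog C) (input N) (10 + T0 + 20 + T)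
  (fun s' => prime (s' 0) /\ prime (s' 1) /\ N = s' 0 * s' 1)) as R.
{ unfold factor_prog.
  apply runs_seq_store with (T' := (T0 + 20 + T)%nat); reg; [lia | | lia |].
  { change (input N 0) with N; lia. }
  apply runs_seq with (T1 := T0) (T2 := (20 + T)%nat); [lia|].
  eapply runs_weaken; [apply (bit_length_loop_runs W N) | |];
    reg; try reflexivity; try lia.
  intros s1 (L & F).
  assert (C * s1 2 = V) as EV by (rewrite L; reflexivity).
  pose proof (F 0 ltac:(lia) ltac:(lia)) as F0.
  pose proof (F 1 ltac:(lia) ltac:(lia)) as F1.
  pose proof (F 4 ltac:(lia) ltac:(lia)) as F4.
  clear F; change (s1 0 = N) in F0; change (s1 1 = 0) in F1;
    change (s1 4 = 0) in F4.
  apply runs_seq_store with (T' := T); reg; rewrite ?EV; [clear HW'; clearbody V m0 T; lia .. |].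
  apply (search_loop_runs W V B b p q ds); [reflexivity | lia | try assumption ..].
  reflexivity. }
destruct R as (t & s' & E & Ht & HQ).
exists t; split; [exists s'; auto|].
assert (Z.of_nat T <= 410 * M ^ 3).
{ pose proof (search_time_bound m0 B M ltac:(lia) ltac:(lia) ltac:(lia)) as Hb.
  replace (Z.of_nat T)
    with ((m0 + 1) * (m0 * (20 * B + 100) + 80 * B + 200) + 10) by (unfold T, m, b; lia).
  pose proof (Z.pow_pos_nonneg M 3 ltac:(lia) ltac:(lia)); lia. }
assert (M <= M ^ 3).
{ rewrite <- (Z.pow_1_r M) at 1; apply Z.pow_le_mono_r; lia. }
unfold T0 in Ht; clearbody T; lia.
Qed.

(** * Encoding signed sums of powers of two *)

(** The residues 2, 0, 1 code the signs -1, 0, 1. *)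
Definition encode_term (t : Z * Z) : Z := 3 * snd t + fst t mod 3.

Lemma digit_term_encode a v :
  a = -1 \/ a = 0 \/ a = 1 -> digit_term (encode_term (a, v)) = a * 2 ^ v.
Proof.
intros Ha; unfold digit_term, encode_term; cbn [fst snd].
replace ((3 * v + a mod 3) / 3) with v.
- f_equal; rewrite <- Z.add_assoc, Z.add_comm, Z.mul_comm, Z.mod_add by lia.
  destruct Ha as [-> | [-> | ->]]; reflexivity.
- rewrite Z.mul_comm, Z.div_add_l, Z.div_small by
    (lia || now apply Z.mod_pos_bound); lia.
Qed.

Lemma encode_terms V l :
  (forall a v, In (a, v) l -> (a = -1 \/ a = 0 \/ a = 1) /\ 1 <= v <= V) ->
  digits (3 * (V + 1)) (map encode_term l) /\
  digits_sum (map encode_term l) = signed_sum l.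
Proof.
induction l as [|[a v] l IH]; intros Hl; [split; [constructor | reflexivity]|].
destruct (Hl a v (or_introl eq_refl)) as [Ha Hv].
destruct IH as [D S]; [intros; apply Hl; now right|].
split.
- constructor; [|exact D].
  pose proof (Z.mod_pos_bound a 3 ltac:(lia)); unfold encode_term; cbn [fst snd]; lia.
- change (digit_term (encode_term (a, v)) + digits_sum (map encode_term l)
          = a * 2 ^ v + signed_sum l).
  now rewrite digit_term_encode, S.
Qed.

(** * Growth estimates *)

Open Scope R_scope.

Lemma ln_4_gt_1 : 1 < ln 4.
Proof.
rewrite <- (ln_exp 1); apply ln_increasing; [apply exp_pos|].
pose proof exp_le_3; lra.
Qed.

(** A positive lower bound for log log N at all N >= 4, by which additive constants become multiples
    of log log N. *)
Lemma ln_ln_4_pos : 0 < ln (ln 4).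
Proof. rewrite <- ln_1; apply ln_increasing; [lra | apply ln_4_gt_1]. Qed.

Lemma ln_le_compat x y : 0 < x -> x <= y -> ln x <= ln y.
Proof.
intros Hx [H | ->]; [left; now apply ln_increasing | apply Rle_refl].
Qed.

Lemma exp_le_compat x y : x <= y -> exp x <= exp y.
Proof. intros [H | ->]; [left; now apply exp_increasing | apply Rle_refl]. Qed.

Lemma ln_2_lt_1 : ln 2 < 1.
Proof.
rewrite <- (ln_exp 1); apply ln_increasing; [lra|].
pose proof (exp_ineq1 1); lra.
Qed.

Lemma ln_IZR_pow x n :
  (0 < x)%Z -> (0 <= n)%Z -> ln (IZR (x ^ n)) = IZR n * ln (IZR x).
Proof.
intros Hx Hn; rewrite <- (Z2Nat.id n) at 1 by assumption.
rewrite <- pow_IZR, ln_pow by (now apply IZR_lt).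
now rewrite INR_IZR_INZ, Z2Nat.id.
Qed.

(** Take logarithms in 2^(log2 N) <= N < 2^(log2 N + 1) and use 1/2 < ln 2 < 1. *)
Lemma log2_ln_bounds N : (4 <= N)%Z ->
  IZR (Z.log2 N) <= 2 * ln (IZR N) /\ ln (IZR N) <= IZR (Z.log2 N + 1).
Proof.
intros HN; pose proof (Z.log2_nonneg N) as H0.
destruct (Z.log2_spec N ltac:(lia)) as [H1 H2].
pose proof ln_lt_2; pose proof ln_2_lt_1.
apply IZR_le in H1; apply IZR_lt in H2.
assert (0 < IZR N) by (apply IZR_lt; lia).
assert (0 <= IZR (Z.log2 N)) by (apply IZR_le; lia).
split.
- apply ln_le_compat in H1; [|apply IZR_lt, Z.pow_pos_nonneg; lia].
  rewrite ln_IZR_pow in H1 by lia; nra.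
- apply ln_increasing in H2; [|assumption].
  rewrite ln_IZR_pow, <- Z.add_1_r in H2 by lia.
  rewrite plus_IZR in *; nra.
Qed.

(* ln y <= y at y = x / a. *)
Lemma Rpower_le_exp x a : 0 < x -> 0 < a -> Rpower x a <= Rpower a a * exp x.
Proof.
intros Hx Ha; unfold Rpower; rewrite <- exp_plus; apply exp_le_compat.
assert (0 < x / a) by now apply Rdiv_lt_0_compat.
assert (ln (x / a) <= x / a) as H1.
{ rewrite <- (ln_exp (x / a)) at 2; apply ln_le_compat; [assumption|].
  pose proof (exp_ineq1_le (x / a)); lra. }
unfold Rdiv in H1 at 1.
rewrite ln_mult, ln_Rinv in H1 by (auto using Rinv_0_lt_compat).
apply (Rmult_le_compat_l a) in H1; [|lra].
replace (a * (x / a)) with x in H1 by (field; lra); lra.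
Qed.

Lemma base_growth C : (1 <= C)%Z -> exists beta, 0 < beta /\
  forall N : Z, (4 <= N)%Z ->
  ln (IZR (3 * (C * (Z.log2 N + 1) + 1))) <= beta * loglog N.
Proof.
intros HC; apply IZR_le in HC.
pose proof ln_ln_4_pos as Hl4.
(* As log2 N <= 2 ln N and 1 < ln N, the base is at most (6 C + 3 C + 3) ln N. *)
set (a := 9 * IZR C + 3).
assert (0 < ln a) by (rewrite <- ln_1; apply ln_increasing; unfold a; lra).
assert (0 < ln a / ln (ln 4)) by now apply Rdiv_lt_0_compat.
exists (ln a / ln (ln 4) + 1); split; [lra|].
intros N HN; destruct (log2_ln_bounds N HN) as [Hlog _].
pose proof (Z.log2_nonneg N) as Hlog0; apply IZR_le in Hlog0.
pose proof ln_4_gt_1.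
assert (ln 4 <= ln (IZR N)) as Hln by (apply ln_le_compat; [lra | now apply IZR_le]).
assert (ln (ln 4) <= loglog N) as Hll by (apply ln_le_compat; lra).
apply Rle_trans with (ln a + loglog N).
- unfold loglog; rewrite <- ln_mult by (unfold a; lra).
  rewrite ?mult_IZR, ?plus_IZR, ?mult_IZR, ?plus_IZR.
  apply ln_le_compat; unfold a; nra.
- apply (Rmult_le_compat_l (ln a / ln (ln 4))) in Hll; [|lra].
  replace (ln a / ln (ln 4) * ln (ln 4)) with (ln a) in Hll by (field; lra); lra.
Qed.

Lemma enumeration_growth c c0 C : 0 < c -> 0 < c0 -> (1 <= C)%Z ->
  exists gamma, 0 < gamma /\
  forall (N : Z) (k : nat), (4 <= N)%Z -> INR k <= c0 * Rpower (loglog N) c ->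
  ln (IZR ((3 * (C * (Z.log2 N + 1) + 1)) ^ (Z.of_nat k + 1))) <=
  gamma * (Rpower (loglog N) c * loglog N).
Proof.
intros Hc Hc0 HC; destruct (base_growth C HC) as (beta & Hbeta & Hb).
pose proof ln_ln_4_pos as Hl4.
set (r := Rpower (ln (ln 4)) c).
assert (0 < r) by apply exp_pos.
assert (0 < / r) by now apply Rinv_0_lt_compat.
(* The summand 1 in the exponent k + 1 is absorbed by 1 <= (log log N)^c / r. *)
exists ((c0 + / r) * beta); split; [apply Rmult_lt_0_compat; lra|].
intros N k HN Hk; specialize (Hb N HN).
pose proof (Z.log2_nonneg N).
pose proof ln_4_gt_1.
assert (ln 4 <= ln (IZR N)) as Hln by (apply ln_le_compat; [lra | now apply IZR_le]).
assert (ln (ln 4) <= loglog N) as Hll by (apply ln_le_compat; lra).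
assert (r <= Rpower (loglog N) c) as Hr by (apply Rle_Rpower_l; lra).
rewrite ln_IZR_pow by nia.
set (x := Rpower (loglog N) c) in *.
assert (1 <= / r * x).
{ apply (Rmult_le_compat_l (/ r)) in Hr; [|lra].
  rewrite Rinv_l in Hr by lra; assumption. }
replace ((c0 + / r) * beta * (x * loglog N))
  with (((c0 + / r) * x) * (beta * loglog N)) by ring.
pose proof (pos_INR k) as Hk0; rewrite plus_IZR, <- INR_IZR_INZ.
apply Rmult_le_compat; [lra | | lra | assumption].
rewrite <- ln_1; apply ln_le_compat; [lra | apply IZR_le; nia].
Qed.

(** * Choice of the constants, and the resulting word and time bounds *)

Theorem theorem7 (c c0 c1 : R) (hc : 0 < c) (hc0 : 0 < c0) (hc1 : 0 < c1) :
  exists (P : cmd) (w : nat) (c2 X0 : R),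
    0 < c2 /\ 0 < X0 /\
    forall X : R, X0 <= X ->
    forall N : Z, in_C c c0 c1 X N ->
    exists t : nat,
      factors_in P (N ^ Z.of_nat w)%Z N t /\ INR t <= superpoly c c2 N.
Proof.
set (C := Z.max 1 (up c1)).
assert (1 <= C)%Z as HC by lia.
assert (c1 <= IZR C) as Hc1C.
{ destruct (archimed c1) as [H _].
  apply Rle_trans with (IZR (up c1)); [lra | apply IZR_le; lia]. }
destruct (enumeration_growth c c0 C hc hc0 HC) as (gamma & Hg & Hgrowth).
pose proof ln_ln_4_pos as Hl4; pose proof ln_4_gt_1.
(* The constant of [Rpower_le_exp] in (log log N)^(c + 1) <= delta * ln N. *)
set (delta := Rpower (c + 1) (c + 1)).
assert (0 < delta) by apply exp_pos.
set (w1 := Z.max 0 (up (gamma * delta))).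
assert (gamma * delta <= IZR w1) as Hw1.
{ destruct (archimed (gamma * delta)) as [H1 _].
  apply Rle_trans with (IZR (up (gamma * delta))); [lra | apply IZR_le; lia]. }
set (r := Rpower (ln (ln 4)) c * ln (ln 4)).
assert (0 < r) by (apply Rmult_lt_0_compat; [apply exp_pos | assumption]).
assert (0 < ln 1000) by (rewrite <- ln_1; apply ln_increasing; lra).
assert (0 < ln 1000 / r) by now apply Rdiv_lt_0_compat.
(* In the word exponent, [w1] pays for [M], 2 C for 2^V, and 3 for the remaining factor 16 N. In
   [c2], the first summand pays for the factor 1000 and the second for the cube of [M]. *)
exists (factor_prog C), (Z.to_nat (w1 + 2 * C + 3)), (ln 1000 / r + 3 * gamma), 1.
do 2 (split; [lra|]).
intros X _ N (_ & p & q & Hp & Hq & EN & l & El & Hlen & Hl).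
pose proof (prime_ge_2 p Hp); pose proof (prime_ge_2 q Hq).
assert (4 <= N)%Z as HN by nia.
destruct (log2_ln_bounds N HN) as [_ Hlog].
pose proof (Z.log2_nonneg N).
assert (0 < ln (IZR N)) as Hln0.
{ apply Rlt_le_trans with (ln 4); [lra|].
  apply ln_le_compat; [lra | now apply IZR_le]. }
assert (ln (ln 4) <= loglog N) as Hll.
{ apply ln_le_compat; [lra|]; apply ln_le_compat; [lra | now apply IZR_le]. }
set (V := (C * (Z.log2 N + 1))%Z).
destruct (encode_terms V l) as [Dig Sum].
{ intros a v Hav; destruct (Hl a v Hav) as (Ha & Hv1 & Hv2).
  repeat split; auto; apply le_IZR; unfold V; rewrite mult_IZR.
  apply Rle_trans with (1 := Hv2).
  apply Rmult_le_compat; lra. }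
set (B := (3 * (V + 1))%Z) in *.
set (M := (B ^ (Z.of_nat (length l) + 1))%Z).
assert (0 < M)%Z as HM by (apply Z.pow_pos_nonneg; nia).
assert (ln (IZR M) <= gamma * (Rpower (loglog N) c * loglog N)) as HlnM
  by now apply Hgrowth.
set (x := Rpower (loglog N) c * loglog N) in *.
assert (r <= x) as Hrx.
{ apply Rmult_le_compat; [left; apply exp_pos | lra | apply Rle_Rpower_l; lra | lra]. }
assert (x <= delta * ln (IZR N)) as Hx.
{ replace x with (Rpower (loglog N) (c + 1)).
  - replace (ln (IZR N)) with (exp (loglog N)) by now apply exp_ln.
    apply Rpower_le_exp; lra.
  - rewrite Rpower_plus, Rpower_1; [reflexivity | lra]. }
assert (M <= N ^ w1)%Z as HMw.
{ apply le_IZR.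
  rewrite <- (exp_ln (IZR M)), <- (exp_ln (IZR (N ^ w1)))
    by (apply IZR_lt; lia || apply Z.pow_pos_nonneg; lia).
  apply exp_le_compat.
  rewrite ln_IZR_pow by lia.
  apply Rle_trans with (1 := HlnM), Rle_trans with (gamma * (delta * ln (IZR N))).
  - apply Rmult_le_compat_l; lra.
  - rewrite <- Rmult_assoc; apply Rmult_le_compat_r; lra. }
(* Raise 2^(log2 N + 1) <= 2 N <= N^2 to the power C. *)
assert (2 ^ V <= N ^ (2 * C))%Z as HVw.
{ unfold V; rewrite (Z.mul_comm C), !Z.pow_mul_r by lia.
  apply Z.pow_le_mono_l; split; [apply Z.pow_nonneg; lia|].
  rewrite Z.pow_add_r, Z.pow_1_r, Z.pow_2_r by lia.
  destruct (Z.log2_spec N ltac:(lia)); nia. }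
destruct (factor_prog_runs (N ^ Z.of_nat (Z.to_nat (w1 + 2 * C + 3))) C p q
            (map encode_term l)) as (t & Ht & Htime); auto;
  rewrite <- ?EN, ?length_map; fold V B M; auto.
- now rewrite Sum.
- rewrite Z2Nat.id, !Z.pow_add_r by lia.
  assert (0 < 2 ^ V)%Z by (apply Z.pow_pos_nonneg; lia).
  assert (M * 2 ^ V <= N ^ w1 * N ^ (2 * C))%Z
    by (apply Z.mul_le_mono_nonneg; lia).
  assert (N <= N ^ (2 * C))%Z
    by (rewrite <- (Z.pow_1_r N) at 1; apply Z.pow_le_mono_r; lia).
  assert (1 <= N ^ w1)%Z by lia.
  set (Y := (N ^ w1 * N ^ (2 * C))%Z) in *.
  assert (N <= Y)%Z by (unfold Y; nia).
  replace (N ^ 3)%Z with (N * (N * N))%Z by ring.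
  assert (16 <= N * N)%Z by nia.
  apply Z.le_trans with (8 * N * (2 * Y))%Z.
  + apply Z.mul_le_mono_nonneg_l; lia.
  + replace (8 * N * (2 * Y))%Z with ((N * Y) * 16)%Z by ring.
    replace (Y * (N * (N * N)))%Z with ((N * Y) * (N * N))%Z by ring.
    apply Z.mul_le_mono_nonneg_l; nia.
- exists t; split; [rewrite EN at 2; assumption|].
  rewrite <- EN, length_map in Htime; fold V B M in Htime.
  apply IZR_le in Htime; rewrite <- INR_IZR_INZ, mult_IZR in Htime.
  apply Rle_trans with (1 := Htime).
  assert (0 < IZR (M ^ 3)) by (apply IZR_lt, Z.pow_pos_nonneg; lia).
  rewrite <- (exp_ln (1000 * IZR (M ^ 3))) by lra.
  rewrite ln_mult, ln_IZR_pow by (lra || lia).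
  unfold superpoly, Rpower at 1; apply exp_le_compat.
  (* The exponent becomes c2 * x, and r <= x turns ln 1000 into a multiple of x. *)
  fold (loglog N); rewrite Rmult_assoc; fold x.
  apply (Rmult_le_compat_l (ln 1000 / r)) in Hrx; [|lra].
  replace (ln 1000 / r * r) with (ln 1000) in Hrx by (field; lra).
  lra.
Qed.
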